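(* Let $\mathcal{A}$ be a preabelian category. The following are equivalent: (i) $\mathcal{A}$ is integral. (ii) For every commutative square in $\mathcal{A}$ consisting of morphisms $g\colon C\to D$, $\alpha\colon C\to A$, $\beta\colon D\to B$, $f\colon A\to B$ with $\beta g=f\alpha$: if the square is a pushout, then the canonical morphism $\hat\alpha\colon \operatorname{Ker} g\to\operatorname{Ker} f$ is an epimorphism; and if the square is a pullback, then the canonical morphism $\hat\beta\colon\operatorname{Cok} g\to\operatorname{Cok} f$ is a monomorphism.
   Context: A preabelian category is an additive category in which every morphism has a kernel and a cokernel. For a morphism $h\colon X\to Y$, write $\ker h\colon\operatorname{Ker} h\to X$ for its kernel and $\operatorname{cok} h\colon Y\to\operatorname{Cok} h$ for its cokernel. A preabelian category is left integral if pullbacks of epimorphisms (along arbitrary morphisms) are epimorphisms, right integral if pushouts of monomorphisms (along arbitrary morphisms) are monomorphisms, and integral if it is both left and right integral. For a commutative square $\beta g=f\alpha$ as in the claim, $\hat\alpha\colon\operatorname{Ker} g\to\operatorname{Ker} f$ is the unique morphism with $\alpha\ker g=(\ker f)\hat\alpha$, and $\hat\beta\colon\operatorname{Cok} g\to\operatorname{Cok} f$ is the unique morphism with $(\operatorname{cok} f)\beta=\hat\beta\operatorname{cok} g$. *)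

(* Defs.v *)
From mathcomp Require Import all_boot ssralg.
From mathcomp Require Import boolp.

Set Implicit Arguments.
Unset Strict Implicit.
Unset Printing Implicit Defensive.

Import GRing.Theory.
Local Open Scope ring_scope.

Declare Scope cat_scope.
Delimit Scope cat_scope with cat.

(* [compm v u] is "v after u". *)
Record preadditiveCategory := PreadditiveCategory {
  ob :> Type;
  Hom : ob -> ob -> zmodType;
  idm : forall X : ob, Hom X X;
  compm : forall X Y Z : ob, Hom Y Z -> Hom X Y -> Hom X Z;
  compA : forall (W X Y Z : ob) (w : Hom Y Z) (v : Hom X Y) (u : Hom W X),
    compm w (compm v u) = compm (compm w v) u;
  comp1m : forall (X Y : ob) (u : Hom X Y), compm (idm Y) u = u;
  compm1 : forall (X Y : ob) (u : Hom X Y), compm u (idm X) = u;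
  compDl : forall (X Y Z : ob) (v v' : Hom Y Z) (u : Hom X Y),
    compm (v + v') u = compm v u + compm v' u;
  compDr : forall (X Y Z : ob) (v : Hom Y Z) (u u' : Hom X Y),
    compm v (u + u') = compm v u + compm v u'
}.

Arguments Hom {_} _ _.
Arguments idm {_} _.
Arguments compm {_ _ _ _} _ _.

Notation "v \o u" := (compm v u) : cat_scope.
Local Open Scope cat_scope.

Section Notions.
Variable CC : preadditiveCategory.
Implicit Types X Y Z : CC.

Definition epi X Y (h : Hom X Y) : Prop :=
  forall (Z : CC) (u v : Hom Y Z), u \o h = v \o h -> u = v.

Definition mono X Y (h : Hom X Y) : Prop :=
  forall (Z : CC) (u v : Hom Z X), h \o u = h \o v -> u = v.

Definition is_zero_object Z : Prop :=
  (forall X, exists! u : Hom Z X, True) /\ (forall X, exists! u : Hom X Z, True).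

Definition is_biproduct X Y P (i1 : Hom X P) (i2 : Hom Y P)
    (p1 : Hom P X) (p2 : Hom P Y) : Prop :=
  [/\ p1 \o i1 = idm X, p2 \o i2 = idm Y, p1 \o i2 = 0, p2 \o i1 = 0
    & (i1 \o p1) + (i2 \o p2) = idm P].

Definition is_additive : Prop :=
  (exists Z, is_zero_object Z) /\
  (forall X Y, exists (P : CC) (i1 : Hom X P) (i2 : Hom Y P)
     (p1 : Hom P X) (p2 : Hom P Y), is_biproduct i1 i2 p1 p2).

Definition is_kernel X Y (h : Hom X Y) K (k : Hom K X) : Prop :=
  h \o k = 0 /\
  forall (T : CC) (t : Hom T X), h \o t = 0 -> exists! u : Hom T K, k \o u = t.

Definition is_cokernel X Y (h : Hom X Y) Q (q : Hom Y Q) : Prop :=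
  q \o h = 0 /\
  forall (T : CC) (t : Hom Y T), t \o h = 0 -> exists! u : Hom Q T, u \o q = t.

Definition is_preabelian : Prop :=
  [/\ is_additive,
      forall X Y (h : Hom X Y), exists (K : CC) (k : Hom K X), is_kernel h k
    & forall X Y (h : Hom X Y), exists (Q : CC) (q : Hom Y Q), is_cokernel h q].

(* Argument order [g a b f] refers to the square
<<
        g
     C ---> D
     |      |
   a |      | b
     v      v
     A ---> B
        f
>>
*)
Definition commutes (C D A B : CC) (g : Hom C D) (a : Hom C A) (b : Hom D B)
    (f : Hom A B) : Prop :=
  b \o g = f \o a.

Definition is_pushout (C D A B : CC) (g : Hom C D) (a : Hom C A) (b : Hom D B)
    (f : Hom A B) : Prop :=
  commutes g a b f /\
  forall (T : CC) (x : Hom D T) (y : Hom A T), x \o g = y \o a ->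
    exists! u : Hom B T, u \o b = x /\ u \o f = y.

Definition is_pullback (C D A B : CC) (g : Hom C D) (a : Hom C A) (b : Hom D B)
    (f : Hom A B) : Prop :=
  commutes g a b f /\
  forall (T : CC) (x : Hom T D) (y : Hom T A), b \o x = f \o y ->
    exists! u : Hom T C, g \o u = x /\ a \o u = y.

Definition left_integral : Prop :=
  forall (C D A B : CC) (g : Hom C D) (a : Hom C A) (b : Hom D B)
    (f : Hom A B), is_pullback g a b f -> epi f -> epi g.

Definition right_integral : Prop :=
  forall (C D A B : CC) (g : Hom C D) (a : Hom C A) (b : Hom D B)
    (f : Hom A B), is_pushout g a b f -> mono g -> mono f.

Definition integral : Prop := left_integral /\ right_integral.

End Notions.

Record preabelianCategory := PreabelianCategory {
  preabelian_base :> preadditiveCategory;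
  preabelianP : is_preabelian preabelian_base
}.

Section Preabelian.
Variable CC : preabelianCategory.
Implicit Types X Y : CC.

Lemma kernel_exists X Y (h : Hom X Y) :
  exists Kk : {K : CC & Hom K X}, is_kernel h (projT2 Kk).
Proof.
by have [_ /(_ X Y h)[K [k kP]] _] := preabelianP CC; exists (existT _ K k).
Qed.

Lemma cokernel_exists X Y (h : Hom X Y) :
  exists Qq : {Q : CC & Hom Y Q}, is_cokernel h (projT2 Qq).
Proof.
by have [_ _ /(_ X Y h)[Q [q qP]]] := preabelianP CC; exists (existT _ Q q).
Qed.

(* Existence of kernels and cokernels is a mere proposition in
   [is_preabelian]; we fix one of each by choice. *)
Definition Ker X Y (h : Hom X Y) : CC := projT1 (sval (cid (kernel_exists h))).

Definition ker X Y (h : Hom X Y) : Hom (Ker h) X :=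
  projT2 (sval (cid (kernel_exists h))).

Definition Cok X Y (h : Hom X Y) : CC := projT1 (sval (cid (cokernel_exists h))).

Definition cok X Y (h : Hom X Y) : Hom Y (Cok h) :=
  projT2 (sval (cid (cokernel_exists h))).

Lemma kerP X Y (h : Hom X Y) : is_kernel h (ker h).
Proof. exact: svalP (cid (kernel_exists h)). Qed.

Lemma cokP X Y (h : Hom X Y) : is_cokernel h (cok h).
Proof. exact: svalP (cid (cokernel_exists h)). Qed.

Lemma comp0m X Y (Z : CC) (u : Hom X Y) : (0 : Hom Y Z) \o u = 0.
Proof. by apply: (@addrI _ ((0 : Hom Y Z) \o u)); rewrite -compDl !addr0. Qed.

Lemma compm0 X Y (Z : CC) (v : Hom Y Z) : v \o (0 : Hom X Y) = 0.
Proof. by apply: (@addrI _ (v \o (0 : Hom X Y))); rewrite -compDr !addr0. Qed.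

Section Induced.
Variables (C D A B : CC) (g : Hom C D) (a : Hom C A) (b : Hom D B).
Variable f : Hom A B.
Hypothesis sq : commutes g a b f.

Lemma ker_map_exists :
  exists! ahat : Hom (Ker g) (Ker f), a \o ker g = ker f \o ahat.
Proof.
have fak0 : f \o (a \o ker g) = 0.
  by rewrite compA -sq -compA (kerP g).1 compm0.
have [u [uE uU]] := (kerP f).2 _ _ fak0.
by exists u; split=> [//|v vE]; apply: uU.
Qed.

Lemma cok_map_exists :
  exists! bhat : Hom (Cok g) (Cok f), cok f \o b = bhat \o cok g.
Proof.
have cbg0 : (cok f \o b) \o g = 0.
  by rewrite -compA sq compA (cokP f).1 comp0m.
have [u [uE uU]] := (cokP g).2 _ _ cbg0.
by exists u; split=> [//|v vE]; apply: uU.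
Qed.

Definition ker_map : Hom (Ker g) (Ker f) := sval (cid ker_map_exists).

Definition cok_map : Hom (Cok g) (Cok f) := sval (cid cok_map_exists).

Lemma ker_mapE : a \o ker g = ker f \o ker_map.
Proof. exact: (svalP (cid ker_map_exists)).1. Qed.

Lemma cok_mapE : cok f \o b = cok_map \o cok g.
Proof. exact: (svalP (cid cok_map_exists)).1. Qed.

End Induced.
End Preabelian.

(* Main.v *)
From mathcomp Require Import all_boot ssralg.
Require Import Defs.

(** A pushout of [g] and [a] is governed by the map [h = (-g, a)] from [C] to
    the biproduct of [D] and [A].  If [f] kills an element of [A], that element,
    placed in the biproduct, is killed by the cokernel of [h], so it lies in the
    image [ker (cok h)].  In an abelian category it would then come from an
    element of [C], killed by [g]: this is the surjectivity of [Ker g] onto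
    [Ker f].  In an integral category lifting to [C] is possible after covering
    [Ker f] by an epimorphism, for two reasons, one for each half of
    integrality:
    - right integrality makes the map from [C] to the image [ker (cok h)] an
      epimorphism ([image_factor_epi]);
    - left integrality lets this epimorphism be pulled back along
      [Ker f -> ker (cok h)].
    The resulting cover of [Ker f] factors through [Ker g] ([ker_map_epi]).

    Conversely, a morphism is mono exactly when its kernel vanishes.  When [g]
    is mono, [Ker g] is zero, and an epimorphism from [Ker g] to [Ker f] forces
    [Ker f] to be zero ([mono_of_epi_ker_map]).

    The statements on pullbacks and cokernels are the same ones read in the
    opposite category.  For this reason the lemmas speak of arbitrary kernels
    and of arbitrary comparison morphisms between them: the kernels chosen in
    the opposite category need not be the cokernels chosen in the original
    one. *)

Set Implicit Arguments.
Unset Strict Implicit.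
Unset Printing Implicit Defensive.

Import GRing.Theory.
Local Open Scope ring_scope.
Local Open Scope cat_scope.

(** * The opposite category *)

Definition oppreadd (CC : preadditiveCategory) : preadditiveCategory :=
  @PreadditiveCategory CC (fun X Y => Hom Y X) (@idm CC)
    (fun X Y Z v u => u \o v)
    (fun W X Y Z w v u => esym (compA u v w))
    (fun X Y u => compm1 u) (fun X Y u => comp1m u)
    (fun X Y Z v v' u => compDr u v v') (fun X Y Z v u u' => compDl u u' v).

Lemma oppreadd_preabelian (CC : preabelianCategory) :
  is_preabelian (oppreadd CC).
Proof.
have [[[Z [Zto Zfrom]] biprod] kerE cokE] := preabelianP CC.
split; [split|by move=> X Y h; exact: cokE|by move=> X Y h; exact: kerE].
- by exists Z; split.
- move=> X Y; have [P [i1 [i2 [p1 [p2 [pi11 pi22 pi12 pi21 ipD]]]]]] := biprod X Y.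
  by exists P, p1, p2, i1, i2; split.
Qed.

Definition opcat (CC : preabelianCategory) : preabelianCategory :=
  PreabelianCategory (oppreadd_preabelian CC).

Lemma op_is_pushout (CC : preabelianCategory) (C D A B : CC) (g : Hom C D)
    (a : Hom C A) (b : Hom D B) (f : Hom A B) :
  @is_pushout (opcat CC) B A D C f b a g <-> is_pullback g a b f.
Proof.
split=> -[sq univ]; split; try exact: esym sq.
- move=> T x y /esym/(univ T y x)[u [[ua ug] uU]].
  by exists u; split=> // v [vg va]; apply: uU.
- move=> T x y /esym/(univ T y x)[u [[ug ua] uU]].
  by exists u; split=> // v [va vg]; apply: uU.
Qed.

Lemma op_is_pullback (CC : preabelianCategory) (C D A B : CC) (g : Hom C D)
    (a : Hom C A) (b : Hom D B) (f : Hom A B) :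
  @is_pullback (opcat CC) B A D C f b a g <-> is_pushout g a b f.
Proof.
split=> -[sq univ]; split; try exact: esym sq.
- move=> T x y /esym/(univ T y x)[u [[uf ub] uU]].
  by exists u; split=> // v [vb vf]; apply: uU.
- move=> T x y /esym/(univ T y x)[u [[ub uf] uU]].
  by exists u; split=> // v [vf vb]; apply: uU.
Qed.

Lemma op_integral (CC : preabelianCategory) : integral CC -> integral (opcat CC).
Proof.
move=> [lint rint]; split=> C D A B g a b f sq.
- by have /(@op_is_pullback CC)/rint := sq.
- by have /(@op_is_pushout CC)/lint := sq.
Qed.

(** * Additive calculus *)

Section Preabelian.
Variable CC : preabelianCategory.
Implicit Types X Y Z : CC.

Lemma compNl X Y Z (v : Hom Y Z) (u : Hom X Y) : (- v) \o u = - (v \o u).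
Proof. by apply: (@addrI _ (v \o u)); rewrite -compDl !subrr comp0m. Qed.

Lemma compNr X Y Z (v : Hom Y Z) (u : Hom X Y) : v \o (- u) = - (v \o u).
Proof. by apply: (@addrI _ (v \o u)); rewrite -compDr !subrr compm0. Qed.

Lemma compBl X Y Z (v v' : Hom Y Z) (u : Hom X Y) :
  (v - v') \o u = (v \o u) - (v' \o u).
Proof. by rewrite compDl compNl. Qed.

Lemma compBr X Y Z (v : Hom Y Z) (u u' : Hom X Y) :
  v \o (u - u') = (v \o u) - (v \o u').
Proof. by rewrite compDr compNr. Qed.

Lemma epi_of_zero X Y (h : Hom X Y) :
  (forall Z (u : Hom Y Z), u \o h = 0 -> u = 0) -> epi h.
Proof.
move=> h0 Z u v uv; apply/eqP; rewrite -subr_eq0; apply/eqP/h0.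
by rewrite compBl uv subrr.
Qed.

Lemma mono_of_zero X Y (h : Hom X Y) :
  (forall Z (u : Hom Z X), h \o u = 0 -> u = 0) -> mono h.
Proof.
move=> h0 Z u v uv; apply/eqP; rewrite -subr_eq0; apply/eqP/h0.
by rewrite compBr uv subrr.
Qed.

Lemma epi_eq0 X Y Z (h : Hom X Y) (u : Hom Y Z) :
  epi h -> u \o h = 0 -> u = 0.
Proof. by move=> hE uh0; apply: hE; rewrite uh0 comp0m. Qed.

Lemma mono_eq0 X Y Z (h : Hom X Y) (u : Hom Z X) :
  mono h -> h \o u = 0 -> u = 0.
Proof. by move=> hM hu0; apply: hM; rewrite hu0 compm0. Qed.

Lemma epi_comp_l X Y Z (v : Hom Y Z) (u : Hom X Y) : epi (v \o u) -> epi v.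
Proof. by move=> vuE T s t st; apply: vuE; rewrite !compA st. Qed.

Lemma kernel_mono X Y (h : Hom X Y) K (k : Hom K X) : is_kernel h k -> mono k.
Proof.
move=> [hk0 univ] T u v uv.
have [|w [_ wU]] := univ T (k \o u); first by rewrite compA hk0 comp0m.
by rewrite -(wU u) // -(wU v).
Qed.

Lemma biproduct_exists X Y : exists (P : CC) (i1 : Hom X P) (i2 : Hom Y P)
  (p1 : Hom P X) (p2 : Hom P Y), is_biproduct i1 i2 p1 p2.
Proof. by have [[_ biprod] _ _] := preabelianP CC; exact: biprod. Qed.

(** A pair of maps [x] to [D] and [y] to [A] agrees over [B] exactly when the
    map they define to the biproduct of [D] and [A] is killed by
    [(b \o p1) - (f \o p2)], so the kernel of this difference is the pullback. *)
Lemma pullback_exists (D A B : CC) (b : Hom D B) (f : Hom A B) :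
  exists (C : CC) (g : Hom C D) (a : Hom C A), is_pullback g a b f.
Proof.
have [P [i1 [i2 [p1 [p2 [pi11 pi22 pi12 pi21 ipD]]]]]] := biproduct_exists D A.
have [dk0 univ] := kerP ((b \o p1) - (f \o p2)).
set k := ker _ in dk0 univ; exists (Ker ((b \o p1) - (f \o p2))), (p1 \o k), (p2 \o k).
split.
  by apply/eqP; rewrite -subr_eq0 !compA -compBl dk0.
move=> T x y bxfy.
have [|u [uE uU]] := univ T ((i1 \o x) + (i2 \o y)).
  rewrite compBl !compDr -!compA !(compA p1) !(compA p2).
  rewrite pi11 pi12 pi21 pi22 !comp1m !comp0m !compm0.
  by rewrite addr0 add0r bxfy subrr.
exists u; split.
  rewrite -!compA uE !compDr !compA pi11 pi12 pi21 pi22.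
  by rewrite !comp1m !comp0m addr0 add0r.
move=> v [vx vy]; apply: uU.
by rewrite -vx -vy -!compA !(compA i1) !(compA i2) -compDl ipD comp1m.
Qed.

End Preabelian.

Lemma pushout_exists (CC : preabelianCategory) (C D A : CC) (g : Hom C D)
    (a : Hom C A) :
  exists (B : CC) (b : Hom D B) (f : Hom A B), is_pushout g a b f.
Proof.
have [B [f [b sq]]] := @pullback_exists (opcat CC) A D C a g.
by exists B, b, f; apply/op_is_pullback.
Qed.

(** * From integrality to the comparison morphisms *)

Section Integral.
Variable CC : preabelianCategory.

(** The obstruction to [e] being epi is a nonzero [t] with [t \o e = 0].  A
    pushout of the mono [i] along [t] extends [t], up to a mono, to a map on
    the whole of [Y]; this extension kills [h], so it factors through [cok h]
    and kills [i] as well. *)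
Lemma image_factor_epi (X Y I : CC) (h : Hom X Y) (i : Hom I Y) (e : Hom X I) :
  right_integral CC -> is_kernel (cok h) i -> i \o e = h -> epi e.
Proof.
move=> rint iP ieh; apply: epi_of_zero => T t te0.
have [Q [t' [i' sq]]] := pushout_exists i t.
have i'M : mono i' by apply: rint sq _; exact: kernel_mono iP.
have t'i : t' \o i = i' \o t := sq.1.
have t'h0 : t' \o h = 0 by rewrite -ieh compA t'i -compA te0 compm0.
have [w [wE _]] := (cokP h).2 _ _ t'h0.
by apply: mono_eq0 i'M _; rewrite -t'i -wE -compA iP.1 compm0.
Qed.

Lemma ker_map_epi (C D A B : CC) (g : Hom C D) (a : Hom C A) (b : Hom D B)
    (f : Hom A B) (Kg Kf : CC) (kg : Hom Kg C) (kf : Hom Kf A)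
    (ah : Hom Kg Kf) :
  integral CC -> is_pushout g a b f -> is_kernel g kg -> is_kernel f kf ->
  a \o kg = kf \o ah -> epi ah.
Proof.
move=> [lint rint] [sq univ] kgP kfP ahE.
have [P [i1 [i2 [p1 [p2 [pi11 pi22 pi12 pi21 _]]]]]] := biproduct_exists D A.
pose h := (i2 \o a) - (i1 \o g).
have p1h : p1 \o h = - g.
  by rewrite compBr !compA pi11 pi12 comp1m comp0m sub0r.
have p2h : p2 \o h = a.
  by rewrite compBr !compA pi22 pi21 comp1m comp0m subr0.
(* The two components of [cok h] agree on [C], so they extend to [B]. *)
have [|u [[_ uf] _]] := univ _ (cok h \o i1) (cok h \o i2).
  by apply/eqP; rewrite eq_sym -subr_eq0 -!compA -compBr (cokP h).1.
have chkf0 : cok h \o (i2 \o kf) = 0.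
  by rewrite compA -uf -compA kfP.1 compm0.
pose m := ker (cok h).
have [s [sE _]] := (kerP (cok h)).2 _ _ chkf0.
have [e [eE _]] := (kerP (cok h)).2 _ _ (cokP h).1.
have eEpi : epi e := image_factor_epi rint (kerP _) eE.
have [R [p [q pb]]] := pullback_exists s e.
have pEpi : epi p := lint _ _ _ _ _ _ _ _ pb eEpi.
have hq : h \o q = i2 \o (kf \o p).
  by rewrite -eE -compA -pb.1 compA sE compA.
have gq0 : g \o q = 0.
  apply: oppr_inj; rewrite oppr0 -compNl -p1h -compA hq.
  by rewrite compA pi12 comp0m.
have aq : a \o q = kf \o p by rewrite -p2h -compA hq compA pi22 comp1m.
have [r [rE _]] := kgP.2 _ _ gq0.
have ahr : ah \o r = p.
  by apply: (kernel_mono kfP); rewrite compA -ahE -compA rE.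
by apply: (@epi_comp_l _ _ _ _ ah r); rewrite ahr.
Qed.

End Integral.

Lemma cok_map_mono (CC : preabelianCategory) (C D A B : CC) (g : Hom C D)
    (a : Hom C A) (b : Hom D B) (f : Hom A B) (Qg Qf : CC) (qg : Hom D Qg)
    (qf : Hom B Qf) (bh : Hom Qg Qf) :
  integral CC -> is_pullback g a b f -> is_cokernel g qg -> is_cokernel f qf ->
  qf \o b = bh \o qg -> mono bh.
Proof.
move=> /op_integral int /op_is_pushout sq qgP qfP bhE.
exact: (@ker_map_epi (opcat CC) _ _ _ _ _ _ _ _ _ _ _ _ _ int sq qfP qgP bhE).
Qed.

(** * From the comparison morphisms to integrality *)

Lemma mono_of_epi_ker_map (CC : preabelianCategory) (C D A B : CC)
    (g : Hom C D) (a : Hom C A) (f : Hom A B) (Kg Kf : CC) (kg : Hom Kg C)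
    (kf : Hom Kf A) (ah : Hom Kg Kf) :
  is_kernel g kg -> is_kernel f kf -> a \o kg = kf \o ah -> epi ah ->
  mono g -> mono f.
Proof.
move=> kgP kfP ahE ahEpi gM.
have kg0 : kg = 0 := mono_eq0 gM kgP.1.
have kf0 : kf = 0 by apply: (epi_eq0 ahEpi); rewrite -ahE kg0 compm0.
apply: mono_of_zero => Z u /kfP.2 [v [vE _]].
by rewrite -vE kf0 comp0m.
Qed.

Lemma epi_of_mono_cok_map (CC : preabelianCategory) (C D A B : CC)
    (g : Hom C D) (b : Hom D B) (f : Hom A B) (Qg Qf : CC) (qg : Hom D Qg)
    (qf : Hom B Qf) (bh : Hom Qg Qf) :
  is_cokernel g qg -> is_cokernel f qf -> qf \o b = bh \o qg -> mono bh ->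
  epi f -> epi g.
Proof.
move=> qgP qfP bhE bhM fE.
exact: (@mono_of_epi_ker_map (opcat CC) _ _ _ _ f b g _ _ _ _ _ qfP qgP bhE bhM fE).
Qed.

Theorem proposition3p1 (CC : preabelianCategory) :
  integral CC <->
  (forall (C D A B : CC) (g : Hom C D) (a : Hom C A) (b : Hom D B)
     (f : Hom A B) (sq : commutes g a b f),
     (is_pushout g a b f -> epi (ker_map sq)) /\
     (is_pullback g a b f -> mono (cok_map sq))).
Proof.
split=> [int C D A B g a b f sq | maps].
  split=> [po | pb].
  - exact: ker_map_epi int po (kerP g) (kerP f) (ker_mapE sq).
  - exact: cok_map_mono int pb (cokP g) (cokP f) (cok_mapE sq).
split=> C D A B g a b f sqP.
- apply: epi_of_mono_cok_map (cokP g) (cokP f) (cok_mapE sqP.1) _.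
  exact: (maps _ _ _ _ _ _ _ _ sqP.1).2.
- apply: mono_of_epi_ker_map (kerP g) (kerP f) (ker_mapE sqP.1) _.
  exact: (maps _ _ _ _ _ _ _ _ sqP.1).1.
Qed.
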